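(* Let $\mathsf{Rel}(\mathsf{Pos})$ be the category of posets and weakening relations. Define $\overline{\mathbbm{2}}$ on a weakening relation $r:X\looparrowright Y$ either (span version) by $\overline{\mathbbm{2}}(r)=(\mathbbm{2}^q)^\ast\cdot(\mathbbm{2}^p)_\ast$ where $X\xleftarrow{p}R\xrightarrow{q}Y$ is the graph of $r$, or (cospan version) by $\overline{\mathbbm{2}}(r)=(\mathbbm{2}^k)_\ast\cdot(\mathbbm{2}^j)^\ast$ where $X\xrightarrow{j}C\xleftarrow{k}Y$ is the collage of $r$. These two definitions agree and yield a functor $\overline{\mathbbm{2}}:\mathsf{Rel}(\mathsf{Pos})^{\mathrm{co}}\to\mathsf{Rel}(\mathsf{Pos})$ (sending $X$ to $\mathbbm{2}^X$) with $\overline{\mathbbm{2}}(f_\ast)=(\mathbbm{2}^f)^\ast$ for every monotone $f$; it is universal (hence unique as a locally monotone functor with this property) with respect to the following properties of $F=(-)^\ast\circ\mathbbm{2}^-:\mathsf{Pos}\to\mathsf{Rel}(\mathsf{Pos})$, $f\mapsto(\mathbbm{2}^f)^\ast$: every $Ff$ has a right adjoint $(Ff)^r$ in $\mathsf{Rel}(\mathsf{Pos})^{\mathrm{co}}$; $Fq\cdot(Fp)^r=(Fg)^r\cdot Ff$ for every exact square $p,q,f,g$ in $\mathsf{Pos}$; and $Fe\cdot(Fe)^r=\mathrm{Id}$ for every surjection $e$. Moreover, for all posets $X,Y$ the map $\overline{\mathbbm{2}}_{X,Y}:\mathsf{Rel}(\mathsf{Pos})(X,Y)^{\mathrm{op}}\to\mathsf{Rel}(\mathsf{Pos})(\mathbbm{2}^X,\mathbbm{2}^Y)$,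 $R\mapsto\{(a,b)\mid R[a]\subseteq b\}$, is a complete meet-semilattice homomorphism.
   Context: $\mathbbm{2}=\{0<1\}$; for a poset $X$, $\mathbbm{2}^X$ is the poset of monotone maps $X\to\mathbbm{2}$ (up-sets, ordered by inclusion), and for monotone $f$, $\mathbbm{2}^f$ is precomposition with $f$. A weakening relation $R:A\looparrowright B$ is a subset of $A\times B$ with $a'\le aRb\le b'\Rightarrow a'Rb'$. $\mathsf{Rel}(\mathsf{Pos})$ has posets as objects, weakening relations as arrows, relational composition ($S\cdot R$ = $R$ then $S$), the order $\le_A$ as identity, and homsets ordered by inclusion; $^{\mathrm{co}}$ reverses the homset order and $^{\mathrm{op}}$ on a poset reverses its order. For monotone $f:A\to B$: $f_\ast=\{(a,b)\mid f(a)\le b\}$, $f^\ast=\{(b,a)\mid b\le f(a)\}$. $R[a]=\{y\mid\exists x\in a.\ xRy\}$. The graph of $r$ is $R=\{(x,y)\mid xry\}$ with product order and projections; the collage of $r$ is the poset on the disjoint union $X\sqcup Y$ ordered by the orders of $X$ and $Y$ together with $x\le y$ iff $xry$ (and never $y\le x$), with the two inclusions $j,k$. A square $p:W\to X_1,q:W\to X_2,f:X_1\to Z,g:X_2\to Z$ in $\mathsf{Pos}$ is exact if $fp\le gq$ and whenever $f(x)\le g(y)$ there is $w$ with $x\le p(w)$ and $q(w)\le y$. *)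

(* Defs.v *)
From Stdlib Require Import Relations Bool FinFun.
From Stdlib Require Import FunctionalExtensionality PropExtensionality ProofIrrelevance.

Set Implicit Arguments.
Unset Strict Implicit.

Record poset := Poset {
  carrier :> Type;
  ple : relation carrier;
  ple_order : order carrier ple
}.
Arguments ple {p} x y.
Arguments ple_order p : clear implicits.

Lemma ple_refl (X : poset) (x : X) : ple x x.
Proof. exact (ord_refl _ _ (ple_order X) x). Qed.

Lemma ple_trans (X : poset) (x y z : X) : ple x y -> ple y z -> ple x z.
Proof. exact (ord_trans _ _ (ple_order X) x y z). Qed.

Lemma ple_antisym (X : poset) (x y : X) : ple x y -> ple y x -> x = y.
Proof. exact (ord_antisym _ _ (ple_order X) x y). Qed.

Lemma flip_order (T : Type) (R : relation T) : order T R -> order T (fun x y => R y x).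
Proof.
  intros [r t a]; split; unfold reflexive, transitive, antisymmetric in *; eauto.
Qed.

Definition dual (X : poset) : poset := Poset (flip_order (ple_order X)).

Record mono (X Y : poset) := Mono {
  mono_fun :> X -> Y;
  mono_le : forall x x', ple x x' -> ple (mono_fun x) (mono_fun x')
}.

Lemma mono_eq (X Y : poset) (f g : mono X Y) : (forall x, f x = g x) -> f = g.
Proof.
  destruct f as [f Hf], g as [g Hg]; simpl; intro e.
  apply functional_extensionality in e; subst g.
  f_equal; apply proof_irrelevance.
Qed.

Definition mono_ple (X Y : poset) (f g : mono X Y) : Prop := forall x, ple (f x) (g x).

Lemma mono_ple_order (X Y : poset) : order (mono X Y) (@mono_ple X Y).
Proof.
  split.
  - intros f x; apply ple_refl.
  - intros f g h fg gh x; exact (ple_trans (fg x) (gh x)).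
  - intros f g fg gf; apply mono_eq; intro x; exact (ple_antisym (fg x) (gf x)).
Qed.

Definition mono_id (X : poset) : mono X X :=
  @Mono X X (fun x => x) (fun x x' h => h).

Definition mono_comp (X Y Z : poset) (g : mono Y Z) (f : mono X Y) : mono X Z :=
  @Mono X Z (fun x => g (f x)) (fun x x' h => mono_le g (mono_le f h)).

Lemma bool_le_order : order bool Bool.le.
Proof.
  split; red.
  - intros []; simpl; auto.
  - intros [] [] []; simpl; auto.
  - intros [] []; simpl; congruence.
Qed.

Definition two : poset := Poset bool_le_order.

Definition pow2 (X : poset) : poset := Poset (mono_ple_order X two).

Definition mem (X : poset) (a : pow2 X) (x : X) : Prop := a x = true.

Lemma pow2_map_le (X Y : poset) (f : mono X Y) (b b' : pow2 Y) :
  ple b b' -> @ple (pow2 X) (mono_comp b f) (mono_comp b' f).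
Proof. intros h x; exact (h (f x)). Qed.

Definition pow2_map (X Y : poset) (f : mono X Y) : mono (pow2 Y) (pow2 X) :=
  @Mono (pow2 Y) (pow2 X) (fun b => mono_comp b f) (@pow2_map_le X Y f).

Record wrel (A B : poset) := WRel {
  rel :> A -> B -> Prop;
  rel_weaken : forall a' a b b', ple a' a -> rel a b -> ple b b' -> rel a' b'
}.

Definition wrel_incl (A B : poset) (R S : wrel A B) : Prop := forall a b, R a b -> S a b.

Lemma wrel_eq (A B : poset) (R S : wrel A B) : (forall a b, R a b <-> S a b) -> R = S.
Proof.
  destruct R as [R HR], S as [S HS]; simpl; intro e.
  assert (E : R = S).
  { apply functional_extensionality; intro a.
    apply functional_extensionality; intro b.
    apply propositional_extensionality; apply e. }
  subst S; f_equal; apply proof_irrelevance.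
Qed.

Lemma wrel_incl_order (A B : poset) : order (wrel A B) (@wrel_incl A B).
Proof.
  split.
  - intros R a b h; exact h.
  - intros R S T RS ST a b h; exact (ST a b (RS a b h)).
  - intros R S RS SR; apply wrel_eq; intros a b; split; [apply RS | apply SR].
Qed.

Definition wrel_id (A : poset) : wrel A A.
Proof.
  refine (@WRel A A (fun a a' => ple a a') _).
  intros a' a b b' h1 h2 h3; exact (ple_trans h1 (ple_trans h2 h3)).
Defined.

Definition wrel_comp (A B C : poset) (S : wrel B C) (R : wrel A B) : wrel A C.
Proof.
  refine (@WRel A C (fun a c => exists b, R a b /\ S b c) _).
  intros a' a c c' ha [b [hR hS]] hc; exists b; split.
  - exact (rel_weaken ha hR (ple_refl b)).
  - exact (rel_weaken (ple_refl b) hS hc).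
Defined.

Definition lower_star (A B : poset) (f : mono A B) : wrel A B.
Proof.
  refine (@WRel A B (fun a b => ple (f a) b) _).
  intros a' a b b' ha h hb; exact (ple_trans (mono_le f ha) (ple_trans h hb)).
Defined.

Definition upper_star (A B : poset) (f : mono A B) : wrel B A.
Proof.
  refine (@WRel B A (fun b a => ple b (f a)) _).
  intros b' b a a' hb h ha; exact (ple_trans hb (ple_trans h (mono_le f ha))).
Defined.

Definition rimage (X Y : poset) (R : wrel X Y) (a : pow2 X) (y : Y) : Prop :=
  exists x, mem a x /\ R x y.

Section GraphCollage.
Variables (X Y : poset) (r : wrel X Y).

Definition graph_carrier : Type := {xy : X * Y | r (fst xy) (snd xy)}.

Definition graph_ple (u v : graph_carrier) : Prop :=
  ple (fst (proj1_sig u)) (fst (proj1_sig v)) /\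
  ple (snd (proj1_sig u)) (snd (proj1_sig v)).

Lemma graph_ple_order : order graph_carrier graph_ple.
Proof.
  split.
  - intros u; split; apply ple_refl.
  - intros u v w [h1 h2] [h3 h4]; split; eapply ple_trans; eassumption.
  - intros [[x y] h] [[x' y'] h'] [h1 h2] [h3 h4]; simpl in *.
    pose proof (ple_antisym h1 h3); pose proof (ple_antisym h2 h4); subst.
    f_equal; apply proof_irrelevance.
Qed.

Definition graph : poset := Poset graph_ple_order.

Definition graph_p : mono graph X :=
  @Mono graph X (fun w => fst (proj1_sig w)) (fun _ _ h => proj1 h).

Definition graph_q : mono graph Y :=
  @Mono graph Y (fun w => snd (proj1_sig w)) (fun _ _ h => proj2 h).

Definition collage_ple (u v : X + Y) : Prop :=
  match u, v with
  | inl x, inl x' => ple x x'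
  | inl x, inr y => r x y
  | inr _, inl _ => False
  | inr y, inr y' => ple y y'
  end.

Lemma collage_ple_order : order (X + Y) collage_ple.
Proof.
  split.
  - intros [x|y]; apply ple_refl.
  - intros [u|u] [v|v] [w|w]; simpl; try tauto; intros h1 h2;
      first [exact (ple_trans h1 h2)
            | exact (rel_weaken h1 h2 (ple_refl _))
            | exact (rel_weaken (ple_refl _) h1 h2)].
  - intros [u|u] [v|v]; simpl; try tauto; intros h1 h2; f_equal;
      exact (ple_antisym h1 h2).
Qed.

Definition collage : poset := Poset collage_ple_order.

Definition collage_j : mono X collage :=
  @Mono X collage (fun x => inl x) (fun _ _ h => h).

Definition collage_k : mono Y collage :=
  @Mono Y collage (fun y => inr y) (fun _ _ h => h).

Definition bar2_span : wrel (pow2 X) (pow2 Y) :=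
  wrel_comp (upper_star (pow2_map graph_q)) (lower_star (pow2_map graph_p)).

Definition bar2_cospan : wrel (pow2 X) (pow2 Y) :=
  wrel_comp (lower_star (pow2_map collage_k)) (upper_star (pow2_map collage_j)).

End GraphCollage.

Record cat := Cat {
  ob :> Type;
  hom : ob -> ob -> Type;
  idm : forall A, hom A A;
  comp : forall A B C, hom B C -> hom A B -> hom A C;
  comp_assoc : forall A B C D (h : hom C D) (g : hom B C) (f : hom A B),
    comp h (comp g f) = comp (comp h g) f;
  comp_idl : forall A B (f : hom A B), comp (idm B) f = f;
  comp_idr : forall A B (f : hom A B), comp f (idm A) = f
}.
Arguments hom {c} A B.
Arguments idm {c} A.
Arguments comp {c A B C} g f : rename.

Definition opcat (C : cat) : cat :=
  @Cat C (fun A B => @hom C B A) (fun A => idm A)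
    (fun A B D g f => comp f g)
    (fun A B D E h g f => eq_sym (comp_assoc f g h))
    (fun A B f => comp_idr f) (fun A B f => comp_idl f).

(** Since [co C] has literally the same underlying category as [C],
    [functor_data (co C) D] and [functor_data C (co D)] are both convertible to
    [functor_data C D]; only [locally_monotone] and [right_adjoint] see [co]. *)
Record ocat := OCat {
  ucat :> cat;
  hle : forall A B : ucat, relation (hom A B);
  hle_order : forall A B, order (hom A B) (@hle A B);
  comp_mono : forall (A B C : ucat) (g g' : hom B C) (f f' : hom A B),
    hle g g' -> hle f f' -> hle (comp g f) (comp g' f')
}.
Arguments hle {o A B} f g : rename.
Arguments hle_order o A B : clear implicits.

Definition hom_poset (C : ocat) (A B : C) : poset := Poset (hle_order C A B).

Definition co (C : ocat) : ocat :=
  @OCat (ucat C) (fun A B f g => hle g f)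
    (fun A B => flip_order (hle_order C A B))
    (fun A B D g g' f f' hg hf => comp_mono hg hf).

Record functor_data (C D : cat) := FunctorData {
  fob :> C -> D;
  fmap : forall A B : C, hom A B -> hom (fob A) (fob B)
}.
Arguments fmap {C D} F {A B} f : rename.

Definition is_functor (C D : cat) (F : functor_data C D) : Prop :=
  (forall A, fmap F (idm A) = idm (F A)) /\
  (forall (A B E : C) (g : hom B E) (f : hom A B),
     fmap F (comp g f) = comp (fmap F g) (fmap F f)).

Definition fcomp (C D E : cat) (G : functor_data D E) (F : functor_data C D) :
    functor_data C E :=
  @FunctorData C E (fun A => G (F A)) (fun A B f => fmap G (fmap F f)).

Definition locally_monotone (C D : ocat) (F : functor_data C D) : Prop :=
  forall (A B : C) (f g : hom A B), hle f g -> hle (fmap F f) (fmap F g).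

Definition right_adjoint (K : ocat) (A B : K) (f : hom A B) (g : hom B A) : Prop :=
  hle (idm A) (comp g f) /\ hle (comp f g) (idm B).

Lemma Pos_assoc (A B C D : poset) (h : mono C D) (g : mono B C) (f : mono A B) :
  mono_comp h (mono_comp g f) = mono_comp (mono_comp h g) f.
Proof. apply mono_eq; reflexivity. Qed.

Lemma Pos_idl (A B : poset) (f : mono A B) : mono_comp (mono_id B) f = f.
Proof. apply mono_eq; reflexivity. Qed.

Lemma Pos_idr (A B : poset) (f : mono A B) : mono_comp f (mono_id A) = f.
Proof. apply mono_eq; reflexivity. Qed.

Definition Pos : cat := @Cat poset mono mono_id mono_comp Pos_assoc Pos_idl Pos_idr.

Lemma Rel_assoc (A B C D : poset) (T : wrel C D) (S : wrel B C) (R : wrel A B) :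
  wrel_comp T (wrel_comp S R) = wrel_comp (wrel_comp T S) R.
Proof. apply wrel_eq; intros a d; simpl; firstorder. Qed.

Lemma Rel_idl (A B : poset) (R : wrel A B) : wrel_comp (wrel_id B) R = R.
Proof.
  apply wrel_eq; intros a b; simpl; split.
  - intros [b' [h hb]]; exact (rel_weaken (ple_refl a) h hb).
  - intro h; exists b; split; [exact h | apply ple_refl].
Qed.

Lemma Rel_idr (A B : poset) (R : wrel A B) : wrel_comp R (wrel_id A) = R.
Proof.
  apply wrel_eq; intros a b; simpl; split.
  - intros [a' [ha h]]; exact (rel_weaken ha h (ple_refl b)).
  - intro h; exists a; split; [apply ple_refl | exact h].
Qed.

Lemma Rel_comp_mono (A B C : poset) (S S' : wrel B C) (R R' : wrel A B) :
  wrel_incl S S' -> wrel_incl R R' -> wrel_incl (wrel_comp S R) (wrel_comp S' R').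
Proof. intros hS hR a c [b [h1 h2]]; exists b; split; auto. Qed.

Definition Rel : ocat :=
  @OCat (@Cat poset wrel wrel_id wrel_comp Rel_assoc Rel_idl Rel_idr)
    wrel_incl wrel_incl_order Rel_comp_mono.

Definition lower_star_functor : functor_data Pos Rel :=
  @FunctorData Pos Rel (fun X => X) lower_star.

Definition upper_star_functor : functor_data (opcat Pos) Rel :=
  @FunctorData (opcat Pos) Rel (fun X => X) (fun A B f => upper_star f).

Definition pow2_functor : functor_data Pos (opcat Pos) :=
  @FunctorData Pos (opcat Pos) pow2 pow2_map.

Definition upper_pow2 : functor_data Pos Rel := fcomp upper_star_functor pow2_functor.

Definition bar2 : functor_data (co Rel) Rel :=
  @FunctorData (co Rel) Rel pow2 bar2_span.

Definition exact_square (W X1 X2 Z : poset)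
    (p : mono W X1) (q : mono W X2) (f : mono X1 Z) (g : mono X2 Z) : Prop :=
  (forall w, ple (f (p w)) (g (q w))) /\
  (forall x y, ple (f x) (g y) -> exists w, ple x (p w) /\ ple (q w) y).

(** Right adjoints in an order-enriched category are unique, so "(Ff)^r" is
    rendered by quantifying over all right adjoints of [fmap F f]. *)
Definition has_right_adjoints (K : ocat) (F : functor_data Pos K) : Prop :=
  forall (X Y : poset) (f : mono X Y), exists fr, right_adjoint (K := K) (fmap F f) fr.

Definition preserves_exact_squares (K : ocat) (F : functor_data Pos K) : Prop :=
  forall (W X1 X2 Z : poset)
         (p : mono W X1) (q : mono W X2) (f : mono X1 Z) (g : mono X2 Z),
    exact_square p q f g ->
    forall (pr : @hom K (F X1) (F W)) (gr : @hom K (F Z) (F X2)),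
      right_adjoint (K := K) (fmap F p) pr ->
      right_adjoint (K := K) (fmap F g) gr ->
      comp (fmap F q) pr = comp gr (fmap F f).

Definition splits_surjections (K : ocat) (F : functor_data Pos K) : Prop :=
  forall (X Y : poset) (e : mono X Y), Surjective e ->
    forall er : @hom K (F Y) (F X),
      right_adjoint (K := K) (fmap F e) er -> comp (fmap F e) er = idm (F Y).

Definition extendable (K : ocat) (F : functor_data Pos K) : Prop :=
  is_functor F /\ has_right_adjoints F /\ preserves_exact_squares F /\
  splits_surjections F.

Definition is_extension (C K : ocat) (J : functor_data Pos C) (F : functor_data Pos K)
    (G : functor_data C K) : Prop :=
  is_functor G /\ locally_monotone G /\ fcomp G J = F.

Definition universal (C : ocat) (J : functor_data Pos C) : Prop :=
  extendable J /\
  forall (K : ocat) (F : functor_data Pos K), extendable F ->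
    exists! G : functor_data C K, is_extension J F G.

Definition is_glb (P : poset) (S : P -> Prop) (m : P) : Prop :=
  (forall s, S s -> ple m s) /\ (forall l, (forall s, S s -> ple l s) -> ple l m).

Definition complete_meet_semilattice (P : poset) : Prop :=
  forall S : P -> Prop, exists m, is_glb S m.

Definition complete_meet_hom (P Q : poset) (h : P -> Q) : Prop :=
  complete_meet_semilattice P /\ complete_meet_semilattice Q /\
  forall (S : P -> Prop) (m : P),
    is_glb S m -> is_glb (fun y => exists x, S x /\ y = h x) (h m).

(* Main.v *)
(** The pairs [graph_p, graph_q] present every weakening relation as
    [r = q_* . p^*], and [p^*] is right adjoint to [p_*].  A locally monotone
    functor preserves adjoints, so an extension [G] of [F] along [(-)_*] can only
    be [G r = Fq . (Fp)^r].  This formula does define an extension: exactness of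
    the graph squares gives identities and [G (f_* ) = F f]; exactness of comma
    squares, together with the surjection of the comma object of two graphs onto
    the graph of the composite, gives composition.  The functor [bar2] is the
    instance [F f = (2^f)^*], whose right adjoints for the reversed order are the
    [(2^f)_*]. *)
From Stdlib Require Import FunctionalExtensionality ClassicalEpsilon FinFun.
Require Import Defs.

Set Implicit Arguments.
Unset Strict Implicit.

(** * Adjoints in an order-enriched category *)

Section Adjoints.
Variable K : ocat.

Lemma hle_refl (A B : K) (f : hom A B) : hle f f.
Proof. exact (ple_refl (X := hom_poset A B) f). Qed.

Lemma hle_trans (A B : K) (f g h : hom A B) : hle f g -> hle g h -> hle f h.
Proof. exact (@ple_trans (hom_poset A B) f g h). Qed.

Lemma hle_antisym (A B : K) (f g : hom A B) : hle f g -> hle g f -> f = g.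
Proof. exact (@ple_antisym (hom_poset A B) f g). Qed.

(** Insert the unit of one adjunction and cancel with the counit of the other:
    [g <= (g' f) g = g' (f g) <= g']. *)
Lemma right_adjoint_hle (A B : K) (f : hom A B) (g g' : hom B A) :
  right_adjoint f g -> right_adjoint f g' -> hle g g'.
Proof.
  intros [_ c] [u _].
  apply hle_trans with (comp (comp g' f) g).
  - rewrite <- (comp_idl g) at 1. exact (comp_mono u (hle_refl g)).
  - rewrite <- comp_assoc. rewrite <- (comp_idr g') at 2.
    exact (comp_mono (hle_refl g') c).
Qed.

Lemma right_adjoint_unique (A B : K) (f : hom A B) (g g' : hom B A) :
  right_adjoint f g -> right_adjoint f g' -> g = g'.
Proof. intros h h'; apply hle_antisym; eapply right_adjoint_hle; eassumption. Qed.

Lemma right_adjoint_idm (A : K) : right_adjoint (idm A) (idm A).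
Proof. split; rewrite comp_idl; apply hle_refl. Qed.

Lemma right_adjoint_comp (A B C : K) (f : hom A B) (g : hom B C)
    (fr : hom B A) (gr : hom C B) :
  right_adjoint f fr -> right_adjoint g gr ->
  right_adjoint (comp g f) (comp fr gr).
Proof.
  intros [uf cf] [ug cg]; split.
  - apply hle_trans with (comp fr f); [exact uf|].
    rewrite <- comp_assoc, (comp_assoc gr g f). rewrite <- (comp_idl f) at 1.
    exact (comp_mono (hle_refl fr) (comp_mono ug (hle_refl f))).
  - apply hle_trans with (comp g gr); [|exact cg].
    rewrite <- comp_assoc, (comp_assoc f fr gr). rewrite <- (comp_idl gr) at 2.
    exact (comp_mono (hle_refl g) (comp_mono cf (hle_refl gr))).
Qed.

End Adjoints.

Lemma locally_monotone_right_adjoint (C K : ocat) (G : functor_data C K) :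
  is_functor G -> locally_monotone G ->
  forall (A B : C) (f : hom A B) (g : hom B A),
    right_adjoint f g -> right_adjoint (fmap G f) (fmap G g).
Proof.
  intros [Gid Gcomp] Gle A B f g [u c]; split;
    rewrite <- Gcomp, <- Gid; apply Gle; assumption.
Qed.

(** * Exact squares *)

Lemma exact_graph_id (X : poset) :
  exact_square (graph_p (wrel_id X)) (graph_q (wrel_id X)) (mono_id X) (mono_id X).
Proof.
  split.
  - intros [[x y] h]; exact h.
  - intros x y h; exists (exist _ (x, y) h); split; apply ple_refl.
Qed.

(** Through this square the span formula for [f_*] becomes [(F id)^r . Ff], so the extension
    restricts to [F]. *)
Lemma exact_graph_lower_star (X Y : poset) (f : mono X Y) :
  exact_square (graph_p (lower_star f)) (graph_q (lower_star f)) f (mono_id Y).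
Proof.
  split.
  - intros [[x y] h]; exact h.
  - intros x y h; exists (exist _ (x, y) h); split; apply ple_refl.
Qed.

(** The mixed inequalities of the collage are the instances of [r]. This square relates the span
    formula to the cospan formula. *)
Lemma exact_graph_collage (X Y : poset) (r : wrel X Y) :
  exact_square (graph_p r) (graph_q r) (collage_j r) (collage_k r).
Proof.
  split.
  - intros [[x y] h]; exact h.
  - intros x y h; exists (exist _ (x, y) h); split; apply ple_refl.
Qed.

Section Comma.
Variables (A B Z : poset) (f : mono A Z) (g : mono B Z).

(* The comma object of [f] and [g] is the graph of this relation. *)
Definition comma_rel : wrel A B.
Proof.
  refine (@WRel A B (fun a b => ple (f a) (g b)) _).
  intros a' a b b' ha h hb.
  exact (ple_trans (mono_le f ha) (ple_trans h (mono_le g hb))).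
Defined.

Lemma exact_comma : exact_square (graph_p comma_rel) (graph_q comma_rel) f g.
Proof.
  split.
  - intros [[a b] h]; exact h.
  - intros a b h; exists (exist _ (a, b) h); split; apply ple_refl.
Qed.

End Comma.

Section CommaOfGraphs.
Variables (X Y Z : poset) (s : wrel Y Z) (r : wrel X Y).

Let W := comma_rel (graph_q r) (graph_p s).

(** A point of the comma object is a chain [x r y <= y' s z]; weakening of [s] absorbs the middle
    inequality. *)
Lemma comma_graph_comp_proof (w : graph W) :
  wrel_comp s r (graph_p r (graph_p W w)) (graph_q s (graph_q W w)).
Proof.
  destruct w as [[[[x y] hr] [[y' z] hs]] h]; simpl in *.
  exists y; split; [exact hr|].
  exact (rel_weaken h hs (ple_refl z)).
Qed.

Definition comma_graph_comp : mono (graph W) (graph (wrel_comp s r)).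
Proof.
  refine (@Mono (graph W) (graph (wrel_comp s r))
            (fun w => exist _ (_, _) (comma_graph_comp_proof w)) _).
  intros w w' [[h1 h2] [h3 h4]]; split; assumption.
Defined.

(** A middle point [y] of the composite, taken twice, gives a preimage. It need not be unique, so
    the comma object is in general larger than the graph of the composite. *)
Lemma comma_graph_comp_surj : Surjective comma_graph_comp.
Proof.
  intros [[x z] [y [hr hs]]].
  unshelve eexists.
  - exists (exist _ (x, y) hr, exist _ (y, z) hs); simpl; apply ple_refl.
  - simpl; f_equal; apply ProofIrrelevance.proof_irrelevance.
Qed.

End CommaOfGraphs.

Section GraphInclusion.
Variables (X Y : poset) (r s : wrel X Y) (rs : wrel_incl r s).

Definition graph_incl : mono (graph r) (graph s).
Proof.
  refine (@Mono (graph r) (graph s)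
            (fun w => exist _ (proj1_sig w) (rs (proj2_sig w))) _).
  intros w w' h; exact h.
Defined.

End GraphInclusion.

Lemma graph_factor (X Y : poset) (r : wrel X Y) :
  r = wrel_comp (lower_star (graph_q r)) (upper_star (graph_p r)).
Proof.
  apply wrel_eq; intros x y; split.
  - intro h; exists (exist _ (x, y) h); split; apply ple_refl.
  - intros [[[x' y'] h] [hx hy]]; exact (rel_weaken hx h hy).
Qed.

(** * Extensions along [lower_star_functor] *)

Section SpanExtension.
Variables (K : ocat) (F : functor_data Pos K).
Variable ra : forall X Y : poset, mono X Y -> @hom K (F Y) (F X).
Hypothesis raP : forall (X Y : poset) (f : mono X Y),
  right_adjoint (K := K) (@fmap _ _ F X Y f) (ra f).

(** The right adjoints are a parameter: universality takes them from a choice principle, whereas the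
    choice [(2^f)_*] makes this unfold to [bar2]. *)
Definition span_extension : functor_data Rel K :=
  @FunctorData Rel K F
    (fun (X Y : poset) (r : wrel X Y) =>
       comp (@fmap _ _ F (graph r) Y (graph_q r)) (ra (graph_p r))).

Hypothesis F_ext : extendable F.

Let fmap_comp (X Y Z : poset) (g : mono Y Z) (f : mono X Y) :
  @fmap _ _ F X Z (mono_comp g f) =
  comp (@fmap _ _ F Y Z g) (@fmap _ _ F X Y f).
Proof. apply F_ext. Qed.

Let fmap_id (X : poset) : @fmap _ _ F X X (mono_id X) = idm (F X).
Proof. apply F_ext. Qed.

(** Uniqueness of adjoints makes any choice of them contravariantly functorial. *)
Lemma ra_comp (X Y Z : poset) (g : mono Y Z) (f : mono X Y) :
  ra (mono_comp g f) = comp (ra f) (ra g).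
Proof.
  apply right_adjoint_unique with (1 := raP (mono_comp g f)).
  rewrite fmap_comp; apply right_adjoint_comp; apply raP.
Qed.

Lemma ra_id (X : poset) : ra (mono_id X) = idm (F X).
Proof.
  apply right_adjoint_unique with (1 := raP (mono_id X)).
  rewrite fmap_id; apply right_adjoint_idm.
Qed.

Lemma fmap_ra_exact (W X1 X2 Z : poset)
    (p : mono W X1) (q : mono W X2) (f : mono X1 Z) (g : mono X2 Z) :
  exact_square p q f g ->
  comp (@fmap _ _ F W X2 q) (ra p) = comp (ra g) (@fmap _ _ F X1 Z f).
Proof.
  intro sq; destruct F_ext as [_ [_ [ex _]]].
  exact (ex _ _ _ _ _ _ _ _ sq _ _ (raP p) (raP g)).
Qed.

Lemma span_extension_lower_star (X Y : poset) (f : mono X Y) :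
  fmap span_extension (lower_star f : @hom Rel X Y) = @fmap _ _ F X Y f.
Proof.
  simpl; rewrite (fmap_ra_exact (exact_graph_lower_star f)), ra_id.
  apply comp_idl.
Qed.

Lemma span_extension_idm (X : poset) :
  fmap span_extension (wrel_id X : @hom Rel X X) = idm (F X).
Proof.
  simpl; rewrite (fmap_ra_exact (exact_graph_id X)), ra_id, comp_idl.
  apply fmap_id.
Qed.

Lemma span_extension_comp (X Y Z : poset) (s : wrel Y Z) (r : wrel X Y) :
  fmap span_extension (wrel_comp s r : @hom Rel X Z) =
  comp (fmap span_extension (s : @hom Rel Y Z))
       (fmap span_extension (r : @hom Rel X Y)).
Proof.
  simpl.
  set (W := comma_rel (graph_q r) (graph_p s)).
  pose (e := comma_graph_comp s r : mono (graph W) _).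
  assert (Ee : comp (@fmap _ _ F (graph W) (graph (wrel_comp s r)) e) (ra e)
               = idm _).
  { destruct F_ext as [_ [_ [_ sp]]].
    exact (sp _ _ e (@comma_graph_comp_surj _ _ _ s r) _ (raP e)). }
  assert (Eq : mono_comp (graph_q (wrel_comp s r)) e
               = mono_comp (graph_q s) (graph_q W))
    by (apply mono_eq; reflexivity).
  assert (Ep : mono_comp (graph_p (wrel_comp s r)) e
               = mono_comp (graph_p r) (graph_p W))
    by (apply mono_eq; reflexivity).
  (* Both sides are compared with the span out of the comma object [graph W]. *)
  transitivity (comp (@fmap _ _ F (graph W) Z (mono_comp (graph_q s) (graph_q W)))
                     (ra (mono_comp (graph_p r) (graph_p W)))).
  (* The legs factor through the surjection [e], and the inner [Fe . (Fe)^r] collapses. *)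
  - rewrite <- Eq, <- Ep, fmap_comp, ra_comp.
    rewrite <- comp_assoc, (comp_assoc _ (ra e)), Ee, comp_idl.
    reflexivity.
  (* Exactness of the comma square replaces the inner two factors by [(Fp)^r . Fq], with [p] from
     the graph of [s] and [q] from that of [r]. *)
  - rewrite fmap_comp, ra_comp.
    rewrite <- !comp_assoc; f_equal.
    rewrite !comp_assoc; f_equal.
    exact (fmap_ra_exact (exact_comma (graph_q r) (graph_p s))).
Qed.

(** The legs of the smaller graph factor through the inclusion [i], so [Fi . (Fi)^r] appears in the
    middle and the counit bounds it by the identity. *)
Lemma span_extension_monotone : locally_monotone span_extension.
Proof.
  intros X Y r s rs; simpl in *.
  set (i := graph_incl rs).
  assert (Eq : graph_q r = mono_comp (graph_q s) i)
    by (apply mono_eq; reflexivity).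
  assert (Ep : graph_p r = mono_comp (graph_p s) i)
    by (apply mono_eq; reflexivity).
  rewrite Eq, Ep, fmap_comp, ra_comp.
  rewrite <- comp_assoc, (comp_assoc _ (ra i)).
  apply comp_mono; [apply hle_refl|].
  rewrite <- (comp_idl (ra (graph_p s))) at 2.
  apply comp_mono; [apply raP | apply hle_refl].
Qed.

Lemma fcomp_span_extension : fcomp span_extension lower_star_functor = F.
Proof.
  (* Eta-expanding [F] makes the object maps agree by conversion, so that only the arrow maps remain
     to be compared. *)
  transitivity (@FunctorData Pos K (fob F) (fun A B f => fmap F f));
    [|destruct F; reflexivity].
  unfold fcomp; f_equal.
  apply functional_extensionality_dep; intro X.
  apply functional_extensionality_dep; intro Y.
  apply functional_extensionality; intro f.
  apply span_extension_lower_star.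
Qed.

Lemma span_extension_is_extension :
  is_extension (C := Rel) lower_star_functor F span_extension.
Proof.
  split; [split|split].
  - exact span_extension_idm.
  - intros X Y Z s r; apply span_extension_comp.
  - exact span_extension_monotone.
  - exact fcomp_span_extension.
Qed.

End SpanExtension.

(** * Uniqueness of extensions and universality of [lower_star_functor] *)

Lemma right_adjoint_stars (X Y : poset) (f : mono X Y) :
  @right_adjoint Rel X Y (lower_star f) (upper_star f).
Proof.
  split.
  - intros x x' h; exists (f x'); split; [exact (mono_le f h) | apply ple_refl].
  - intros y y' [x [h h']]; exact (ple_trans h h').
Qed.

Lemma is_extension_graph (K : ocat) (F : functor_data Pos K)
    (ra : forall X Y : poset, mono X Y -> @hom K (F Y) (F X)) :
  (forall (X Y : poset) (f : mono X Y),
     right_adjoint (K := K) (@fmap _ _ F X Y f) (ra X Y f)) ->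
  forall G : functor_data Rel K,
    is_extension lower_star_functor F G -> span_extension ra = G.
Proof.
  intros raP G [Gf [Gle e]]; subst F.
  transitivity (@FunctorData Rel K (fob G) (fun A B r => fmap G r));
    [|destruct G; reflexivity].
  unfold span_extension; f_equal.
  apply functional_extensionality_dep; intro X.
  apply functional_extensionality_dep; intro Y.
  apply functional_extensionality; intro r; simpl.
  transitivity (fmap G (wrel_comp (lower_star (graph_q r))
                         (upper_star (graph_p r)) : @hom Rel X Y));
    [|f_equal; symmetry; apply graph_factor].
  etransitivity; [|symmetry; apply (proj2 Gf)].
  f_equal.
  apply right_adjoint_unique with (1 := raP _ _ (graph_p r)).
  apply (locally_monotone_right_adjoint (C := Rel) Gf Gle), right_adjoint_stars.
Qed.

(** The two clauses of exactness give the two inclusions of [q_* . p^* = g^* . f_*]. *)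
Lemma lower_star_extendable : extendable (K := Rel) lower_star_functor.
Proof.
  split; [split|split; [|split]].
  - reflexivity.
  - intros X Y Z g f; apply wrel_eq; intros x z; simpl; split.
    + intro h; exists (f x); split; [apply ple_refl | exact h].
    + intros [y [h h']]; exact (ple_trans (mono_le g h) h').
  - intros X Y f; exists (upper_star f); apply right_adjoint_stars.
  - intros W X1 X2 Z p q f g [sq ex] pr gr hp hg.
    rewrite (right_adjoint_unique hp (right_adjoint_stars p)).
    rewrite (right_adjoint_unique hg (right_adjoint_stars g)).
    apply wrel_eq; intros x y; simpl; split.
    + intros [w [h h']]; exists (f (p w)); split; [exact (mono_le f h)|].
      exact (ple_trans (sq w) (mono_le g h')).
    + intros [z [h h']]; exact (ex _ _ (ple_trans h h')).
  - intros X Y e se er h.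
    rewrite (right_adjoint_unique h (right_adjoint_stars e)).
    apply wrel_eq; intros y y'; simpl; split.
    + intros [x [h1 h2]]; exact (ple_trans h1 h2).
    + intro hy; destruct (se y) as [x <-]; exists x; split;
        [apply ple_refl | exact hy].
Qed.

Lemma lower_star_universal : universal (C := Rel) lower_star_functor.
Proof.
  split; [exact lower_star_extendable|].
  intros K F HF.
  (* Right adjoints are only known to exist, so description selects one for each arrow. *)
  pose (ra := fun (X Y : poset) (f : mono X Y) =>
    proj1_sig (constructive_indefinite_description _ (proj1 (proj2 HF) X Y f))).
  assert (raP : forall (X Y : poset) (f : mono X Y),
    right_adjoint (K := K) (@fmap _ _ F X Y f) (ra X Y f)).
  { intros X Y f; exact (proj2_sig (constructive_indefinite_description _
      (proj1 (proj2 HF) X Y f))). }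
  exists (span_extension ra); split.
  - exact (span_extension_is_extension raP HF).
  - exact (is_extension_graph raP).
Qed.

(** * The functor [bar2] *)

Lemma pow2_pleP (X : poset) (a b : pow2 X) :
  ple a b <-> (forall x, mem a x -> mem b x).
Proof.
  unfold mem; split.
  - intros h x hx; specialize (h x); simpl in h; rewrite hx in h; exact h.
  - intros h x; specialize (h x); simpl.
    destruct (a x); simpl; [exact (h eq_refl) | exact I].
Qed.

Lemma mem_up (X : poset) (a : pow2 X) (x x' : X) : mem a x -> ple x x' -> mem a x'.
Proof.
  unfold mem; intros h hx; pose proof (mono_le a hx) as l; simpl in l.
  rewrite h in l; exact l.
Qed.

Section UpSet.
Variables (X : poset) (P : X -> Prop).
Hypothesis P_up : forall x x', P x -> ple x x' -> P x'.

(** Up-sets are [bool]-valued maps, so an arbitrary up-closed predicate becomes one by excluded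
    middle. *)
Definition upset : pow2 X.
Proof.
  refine (@Mono X two
            (fun x => if excluded_middle_informative (P x) then true else false) _).
  intros x x' h; simpl.
  destruct (excluded_middle_informative (P x)) as [Px|]; [|exact I].
  destruct (excluded_middle_informative (P x')) as [|n]; [reflexivity|].
  destruct (n (P_up Px h)).
Defined.

Lemma mem_upset (x : X) : mem upset x <-> P x.
Proof.
  unfold mem; simpl; destruct (excluded_middle_informative (P x)); split;
    intro; (assumption || reflexivity || discriminate || contradiction).
Qed.

End UpSet.

(** Reversing the hom-order exchanges unit and counit, so the adjunction between the two stars
    changes direction. *)
Lemma right_adjoint_upper_pow2 (X Y : poset) (f : mono X Y) :
  @right_adjoint (co Rel) (pow2 X) (pow2 Y)
    (upper_star (pow2_map f)) (lower_star (pow2_map f)).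
Proof.
  destruct (right_adjoint_stars (pow2_map f)) as [u c]; split; assumption.
Qed.

(* The witness [c] is the up-set generated by the image of [a] under [f]. *)
Lemma pow2_exact (W X1 X2 Z : poset)
    (p : mono W X1) (q : mono W X2) (f : mono X1 Z) (g : mono X2 Z) :
  exact_square p q f g ->
  wrel_comp (upper_star (pow2_map q)) (lower_star (pow2_map p)) =
  wrel_comp (lower_star (pow2_map g)) (upper_star (pow2_map f)).
Proof.
  intros [sq ex]; apply wrel_eq; intros a b; split.
  - intros [u [h h']].
    pose proof (proj1 (pow2_pleP _ _) (ple_trans h h')) as l; clear u h h'.
    assert (up : forall z z' : Z, (exists x, mem a x /\ ple (f x) z) ->
                 ple z z' -> exists x, mem a x /\ ple (f x) z').
    { intros z z' [x [hx hz]] hz'; exists x; split; [exact hx|].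
      exact (ple_trans hz hz'). }
    exists (upset up); split; apply pow2_pleP.
    + intros x hx; apply (proj2 (mem_upset up (f x))).
      exists x; split; [exact hx | apply ple_refl].
    + intros y hy; destruct (proj1 (mem_upset up (g y)) hy) as [x [hx hz]].
      (* Exactness yields [w] with [x <= p w] and [q w <= y], along which membership passes from [a]
         to [b]. *)
      destruct (ex _ _ hz) as [w [hw hw']].
      exact (mem_up (a := b) (l w (mem_up hx hw)) hw').
  - intros [c [h h']].
    exists (pow2_map p a); split; [apply ple_refl|].
    apply pow2_pleP; intros w hw.
    apply (proj1 (pow2_pleP _ _) h').
    apply (mem_up (a := c) (x := f (p w))); [|apply sq].
    exact (proj1 (pow2_pleP _ _) h (p w) hw).
Qed.

Lemma upper_pow2_extendable : extendable (K := co Rel) upper_pow2.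
Proof.
  split; [split|split; [|split]].
  - intro X; apply wrel_eq; intros a b; reflexivity.
  - intros X Y Z g f; apply wrel_eq; intros a c; split.
    + intro h; exists (pow2_map g c); split; [exact h | apply ple_refl].
    + intros [b [h h']]; exact (ple_trans h (mono_le (pow2_map f) h')).
  - intros X Y f; exists (lower_star (pow2_map f)); apply right_adjoint_upper_pow2.
  - intros W X1 X2 Z p q f g sq pr gr hp hg.
    rewrite (right_adjoint_unique hp (right_adjoint_upper_pow2 p)).
    rewrite (right_adjoint_unique hg (right_adjoint_upper_pow2 g)).
    exact (pow2_exact sq).
  - intros X Y e se er h.
    rewrite (right_adjoint_unique h (right_adjoint_upper_pow2 e)).
    apply wrel_eq; intros a b; split.
    (* Precomposition with a surjection reflects the order. *)
    + intros [c [h1 h2]]; pose proof (ple_trans h1 h2) as l.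
      intro y; destruct (se y) as [x <-]; exact (l x).
    + intro l; exists (pow2_map e a); split; [apply ple_refl|].
      exact (mono_le (pow2_map e) l).
Qed.

(** This is the span extension into [co Rel]. Moving [co] from target to source affects local
    monotonicity only, where the two relations are swapped. *)
Lemma bar2_is_extension :
  @is_extension (co Rel) Rel lower_star_functor upper_pow2 bar2.
Proof.
  destruct (span_extension_is_extension (K := co Rel) (F := upper_pow2)
              (ra := fun X Y f => lower_star (pow2_map f))
              right_adjoint_upper_pow2
              upper_pow2_extendable) as [fct [mon ext]].
  split; [exact fct | split; [|exact ext]].
  intros X Y r s rs; exact (mon X Y s r rs).
Qed.

Lemma bar2_unique :
  unique (@is_extension (co Rel) Rel lower_star_functor upper_pow2) bar2.
Proof.
  split; [exact bar2_is_extension|].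
  intros G [fct [mon ext]].
  apply (is_extension_graph (K := co Rel) (F := upper_pow2)
              (ra := fun X Y f => lower_star (pow2_map f))
              right_adjoint_upper_pow2).
  split; [exact fct | split; [|exact ext]].
  intros X Y r s rs; exact (mon X Y s r rs).
Qed.

Lemma bar2_lower_star (X Y : poset) (f : mono X Y) :
  bar2_span (lower_star f) = upper_star (pow2_map f).
Proof.
  exact (span_extension_lower_star (K := co Rel) (F := upper_pow2)
              (ra := fun X Y f => lower_star (pow2_map f))
              right_adjoint_upper_pow2
           upper_pow2_extendable f).
Qed.

(** Either side says that [2^p a] lies below [2^q b], evaluated at the points [(x, y)] of the
    graph. *)
Lemma bar2_rimage (X Y : poset) (R : wrel X Y) (a : pow2 X) (b : pow2 Y) :
  bar2_span R a b <-> (forall y, rimage R a y -> mem b y).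
Proof.
  split.
  - intros [c [h h']] y [x [hx hR]].
    exact (proj1 (pow2_pleP _ _) (ple_trans h h') (exist _ (x, y) hR) hx).
  - intro h; exists (pow2_map (graph_p R) a); split; [apply ple_refl|].
    apply pow2_pleP; intros [[x y] hR] hx.
    apply (h y); exists x; split; assumption.
Qed.

(** * Complete meets in the hom-posets *)

Section MeetsAndJoins.
Variables (X Y : poset) (S : wrel X Y -> Prop).

Definition wrel_union : wrel X Y.
Proof.
  refine (@WRel X Y (fun x y => exists R, S R /\ R x y) _).
  intros x' x y y' hx [R [SR h]] hy; exists R; split; [exact SR|].
  exact (rel_weaken hx h hy).
Defined.

Definition wrel_inter : wrel X Y.
Proof.
  refine (@WRel X Y (fun x y => forall R, S R -> R x y) _).
  intros x' x y y' hx h hy R SR; exact (rel_weaken hx (h R SR) hy).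
Defined.

(** Meets for the reversed order are joins for inclusion. *)
Lemma wrel_union_glb : is_glb (P := dual (@hom_poset Rel X Y)) S wrel_union.
Proof.
  split.
  - intros R SR x y h; exists R; split; assumption.
  - intros L hL x y [R [SR h]]; exact (hL R SR x y h).
Qed.

Lemma wrel_inter_glb : is_glb (P := @hom_poset Rel X Y) S wrel_inter.
Proof.
  split.
  - intros R SR x y h; exact (h R SR).
  - intros L hL x y h R SR; exact (hL R SR x y h).
Qed.

End MeetsAndJoins.

Lemma bar2_complete_meet_hom (X Y : poset) :
  @complete_meet_hom (dual (@hom_poset Rel X Y)) (@hom_poset Rel (pow2 X) (pow2 Y))
    (@bar2_span X Y).
Proof.
  split; [|split].
  - intro S; exists (wrel_union S); apply wrel_union_glb.
  - intro S; exists (wrel_inter S); apply wrel_inter_glb.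
  - intros S m [lb gr]; split.
    + intros T [R [SR ->]].
      apply bar2_is_extension; exact (lb R SR).
    + intros L hL a b h; apply bar2_rimage; intros y [x [hx hm]].
      (* As a greatest lower bound in the reversed order, [m] is contained in the union, so the pair
         [(x, y)] already lies in some [R] of [S]. *)
      destruct (gr (wrel_union S) (proj1 (wrel_union_glb S)) x y hm)
        as [R [SR hR]].
      assert (hb : bar2_span R a b)
        by (apply (hL (bar2_span R)); [exists R; split; [exact SR | reflexivity] | exact h]).
      apply (proj1 (bar2_rimage R a b) hb); exists x; split; assumption.
Qed.

Theorem theorem4p10 :
  (forall (X Y : poset) (r : wrel X Y), bar2_span r = bar2_cospan r)
  /\ is_functor bar2
  /\ @locally_monotone (co Rel) Rel bar2
  /\ (forall (X Y : poset) (f : mono X Y),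
        fmap bar2 (lower_star f) = upper_star (pow2_map f))
  /\ @extendable (co Rel) upper_pow2
  /\ @universal Rel lower_star_functor
  /\ unique (@is_extension (co Rel) Rel lower_star_functor upper_pow2) bar2
  /\ (forall X Y : poset,
        (forall (R : wrel X Y) (a : pow2 X) (b : pow2 Y),
           fmap bar2 R a b <-> (forall y, rimage R a y -> mem b y))
        /\ @complete_meet_hom (dual (@hom_poset Rel X Y))
             (@hom_poset Rel (pow2 X) (pow2 Y))
             (fun R : wrel X Y => fmap bar2 R)).
Proof.
  split; [intros X Y r; exact (pow2_exact (exact_graph_collage r))|].
  split; [apply bar2_is_extension|].
  split; [apply bar2_is_extension|].
  split; [exact bar2_lower_star|].
  split; [exact upper_pow2_extendable|].
  split; [exact lower_star_universal|].
  split; [exact bar2_unique|].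
  intros X Y; split; [exact (@bar2_rimage X Y) | exact (bar2_complete_meet_hom X Y)].
Qed.
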